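(* Let $1\le r<n$. Let $\mathcal{A}:\mathbb{R}^{n\times n}\to\mathbb{R}^{m}$ be linear, let $M^{\star}\in\mathbb{R}^{n\times n}$ be positive semidefinite with $r^{\star}:=\mathrm{rank}(M^{\star})\le r$, let $b=\mathcal{A}(M^{\star})$, and let $\mathcal{A}$ satisfy $(\delta,r+r^{\star})$-RIP. Define $f_{\mathcal{A}}:\mathbb{R}^{n\times r}\to\mathbb{R}$ by $f_{\mathcal{A}}(X)=\|\mathcal{A}(XX^{T})-b\|^{2}$. \begin{itemize} \item If $\delta<1/(1+\sqrt{r^{\star}/r})$, then for every $X\in\mathbb{R}^{n\times r}$: $\nabla f_{\mathcal{A}}(X)=0$ and $\nabla^{2}f_{\mathcal{A}}(X)\succeq0$ hold if and only if $XX^{T}=M^{\star}$. \item If $\delta\ge1/(1+1/\sqrt{r-r^{\star}+1})$ (and $\delta<1$), then there exist a linear map $\mathcal{A}^{\star}:\mathbb{R}^{n\times n}\to\mathbb{R}^{m}$ (for some $m$) satisfying $(\delta,r+r^{\star})$-RIP, a positive semidefinite $M^{\star}\in\mathbb{R}^{n\times n}$ with $\mathrm{rank}(M^{\star})=r^{\star}$, and $X\in\mathbb{R}^{n\times r}$ with $XX^{T}\ne M^{\star}$ such that, with $f_{\mathcal{A}^{\star}}(U):=\|\mathcal{A}^{\star}(UU^{T}-M^{\star})\|^{2}$, we have $f_{\mathcal{A}^{\star}}(X)>0$, $\nabla f_{\mathcal{A}^{\star}}(X)=0$ and $\nabla^{2}f_{\mathcal{A}^{\star}}(X)\succeq0$.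 \end{itemize}
   Context: A linear map $\mathcal{A}:\mathbb{R}^{n\times n}\to\mathbb{R}^{m}$ satisfies $(\delta,p)$-RIP (restricted isometry property) if $0\le\delta<1$ and there is a rescaling $\nu>0$ such that $(1-\delta)\|E\|_{F}^{2}\le\frac{1}{\nu}\|\mathcal{A}(E)\|^{2}\le(1+\delta)\|E\|_{F}^{2}$ for all $E\in\mathbb{R}^{n\times n}$ with $\mathrm{rank}(E)\le p$. Here $\nabla f$ and $\nabla^{2}f$ denote the gradient and Hessian of $f$ as a function on $\mathbb{R}^{n\times r}$, and $\nabla^{2}f(X)\succeq0$ means the Hessian quadratic form is nonnegative.
   Formalization: In the second bullet r* ≥ 1 is assumed: for r* = 0 one has M* = 0, and a vanishing gradient (tested in the direction X) forces f(X) = 0, so f(X) > 0 is impossible and the claim as written is false. *)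

(* Defs.v *)
From HB Require Import structures.
From mathcomp Require Import all_boot all_order all_algebra.
From mathcomp Require Import all_classical all_reals all_analysis.
Set Implicit Arguments. Unset Strict Implicit. Unset Printing Implicit Defensive.
Import Order.TTheory GRing.Theory Num.Theory.
Import numFieldNormedType.Exports.
Local Open Scope ring_scope.

Definition sqnorm (R : realType) (m : nat) (v : 'cV[R]_m) : R :=
  \sum_(i < m) v i 0 ^+ 2.

Definition frob2 (R : realType) (n k : nat) (E : 'M[R]_(n, k)) : R :=
  \sum_(i < n) \sum_(j < k) E i j ^+ 2.

Definition psd (R : realType) (n : nat) (M : 'M[R]_n) : Prop :=
  M^T = M /\ forall v : 'cV[R]_n, 0 <= (v^T *m M *m v) 0 0.

Definition RIP (R : realType) (n m : nat) (A : {linear 'M[R]_n -> 'cV[R]_m})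
    (delta : R) (p : nat) : Prop :=
  0 <= delta /\ delta < 1 /\
  exists nu : R, 0 < nu /\
    forall E : 'M[R]_n, (\rank E <= p)%N ->
      (1 - delta) * frob2 E <= sqnorm (A E) / nu /\
      sqnorm (A E) / nu <= (1 + delta) * frob2 E.

Definition fA (R : realType) (n r m : nat) (A : {linear 'M[R]_n -> 'cV[R]_m})
    (b : 'cV[R]_m) (X : 'M[R]_(n, r)) : R :=
  sqnorm (A (X *m X^T) - b).

Definition grad_zero (R : realType) (n r : nat) (f : 'M[R]_(n, r) -> R)
    (X : 'M[R]_(n, r)) : Prop :=
  differentiable f X /\ forall V : 'M[R]_(n, r), 'd f X V = 0.

(* Hessian quadratic form nabla^2 f(X)[V,V] = D_V (D_V f) (X) is nonnegative *)
Definition hess_psd (R : realType) (n r : nat) (f : 'M[R]_(n, r) -> R)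
    (X : 'M[R]_(n, r)) : Prop :=
  forall V : 'M[R]_(n, r),
    derivable (fun Y => 'D_V f Y) X V /\ 0 <= 'D_V (fun Y => 'D_V f Y) X.

(* Main.v *)
(* Write E = X X^T - M with M = Z Z^T, h(S, T) = <A S, A T> / nu, and let W be the
   part of Z orthogonal to the columns of X, s the least squared singular value of X.
   At a second-order point h(E, X V^T + V X^T) = 0, so h(E, E1) = 0 for the tangent
   part E1 = E + W W^T; and testing the Hessian at V = w u^T, with w a column of W and
   u a least singular vector, gives h(E, W W^T) >= -(1 + d) s |W|^2.  The RIP on
   E +- d T for the fixed choice T = E1 / d^2 - W W^T bounds h(E, T) below by
   <E, T> - (|E|^2 + d^2 |T|^2) / 2, whence
     (1 - d) (|E1|^2 + d^2 |W W^T|^2) <= 2 d^2 s |W|^2.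
   A polar decomposition of the tangential part of Z shows, for q = sqrt (r / k) and
   k = rank M, that
     2 q^2 (1 + q) s |W|^2 <= (1 + q)^2 |E1|^2 + q^2 |W W^T|^2,
   and the two are compatible with d < q / (1 + q) only if E = 0.

   For the counterexample let e be a unit vector normal to an isometry X, a a unit
   multiple of the projection onto p = r - k + 1 columns of X, b = e e^T, and take
   h(S, T) = (1 + d) <S, T> - d <a - b, S> <a - b, T>.  With E = sqrt p (a - b / d)
   the gradient of h at E is a negative multiple of b, which is invisible to first
   order, and dominated by the curvature exactly when sqrt p (1 - d) <= d. *)
Require Import Defs.
From HB Require Import structures.
From mathcomp Require Import all_boot all_order all_algebra.
From mathcomp Require Import all_classical all_reals all_analysis.
From mathcomp Require Import ring lra.
Set Implicit Arguments. Unset Strict Implicit. Unset Printing Implicit Defensive.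
Import Order.TTheory GRing.Theory Num.Theory.
Import numFieldNormedType.Exports.
Local Open Scope ring_scope.

(** * The Frobenius inner product *)

Definition mip (R : realType) (m n : nat) (A B : 'M[R]_(m, n)) : R :=
  \tr (A^T *m B).

Section InnerProduct.
Context {R : realType}.

Lemma mipE m n (A B : 'M[R]_(m, n)) :
  mip A B = \sum_i \sum_j A i j * B i j.
Proof.
rewrite /mip /mxtrace exchange_big; apply: eq_bigr => j _.
by rewrite mxE; apply: eq_bigr => i _; rewrite mxE.
Qed.

Lemma frob2E m n (A : 'M[R]_(m, n)) : frob2 A = mip A A.
Proof. by rewrite mipE. Qed.

Lemma sqnormE m (v : 'cV[R]_m) : sqnorm v = mip v v.
Proof.
by rewrite mipE; apply: eq_bigr => i _; rewrite big_ord_recl big_ord0 addr0.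
Qed.

Lemma mipC m n (A B : 'M[R]_(m, n)) : mip A B = mip B A.
Proof. by rewrite /mip -mxtrace_tr trmx_mul trmxK. Qed.

Lemma mipDr m n (A B C : 'M[R]_(m, n)) : mip A (B + C) = mip A B + mip A C.
Proof. by rewrite /mip mulmxDr mxtraceD. Qed.

Lemma mipDl m n (A B C : 'M[R]_(m, n)) : mip (B + C) A = mip B A + mip C A.
Proof. by rewrite mipC mipDr !(mipC A). Qed.

Lemma mipZr m n a (A B : 'M[R]_(m, n)) : mip A (a *: B) = a * mip A B.
Proof. by rewrite /mip -scalemxAr mxtraceZ. Qed.

Lemma mipZl m n a (A B : 'M[R]_(m, n)) : mip (a *: B) A = a * mip B A.
Proof. by rewrite mipC mipZr mipC. Qed.

Lemma mipNr m n (A B : 'M[R]_(m, n)) : mip A (- B) = - mip A B.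
Proof. by rewrite -scaleN1r mipZr mulN1r. Qed.

Lemma mipNl m n (A B : 'M[R]_(m, n)) : mip (- B) A = - mip B A.
Proof. by rewrite mipC mipNr mipC. Qed.

Lemma mip0r m n (A : 'M[R]_(m, n)) : mip A 0 = 0.
Proof. by rewrite -(scale0r 0) mipZr mul0r. Qed.

Lemma mip0l m n (A : 'M[R]_(m, n)) : mip 0 A = 0.
Proof. by rewrite mipC mip0r. Qed.

Definition mip_lin := (mipDr, mipDl, mipNr, mipNl, mipZr, mipZl).

Lemma mip_sumr I (s : seq I) m n (A : 'M[R]_(m, n)) F :
  mip A (\sum_(i <- s) F i) = \sum_(i <- s) mip A (F i).
Proof. by elim/big_rec2: _ => [|i x y _ <-]; rewrite ?mip0r ?mipDr. Qed.

Lemma mip_tr m n (A B : 'M[R]_(m, n)) : mip A^T B^T = mip A B.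
Proof. by rewrite /mip trmxK mxtrace_mulC -mxtrace_tr trmx_mul trmxK. Qed.

Lemma mip_mull m n p (A : 'M[R]_(m, n)) (B : 'M[R]_(n, p)) C :
  mip (A *m B) C = mip B (A^T *m C).
Proof. by rewrite /mip trmx_mul mulmxA. Qed.

Lemma mip_mulr m n p (A : 'M[R]_(m, n)) (B : 'M[R]_(n, p)) C :
  mip (A *m B) C = mip A (C *m B^T).
Proof.
by rewrite -mip_tr trmx_mul mip_mull trmxK -[RHS]mip_tr trmx_mul trmxK.
Qed.

Lemma mip_ge0 m n (A : 'M[R]_(m, n)) : 0 <= mip A A.
Proof.
by rewrite mipE; apply: sumr_ge0 => i _; apply: sumr_ge0 => j _; rewrite sqr_ge0.
Qed.

Lemma mip_le0 m n (A : 'M[R]_(m, n)) : mip A A <= 0 -> A = 0.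
Proof.
move=> A0; have {A0} : mip A A = 0 by apply/le_anti; rewrite A0 mip_ge0.
rewrite mipE => /eqP; rewrite psumr_eq0; last first.
  by move=> i _; apply: sumr_ge0 => j _; rewrite sqr_ge0.
move=> /allP A0; apply/matrixP => i j; rewrite mxE.
have := A0 i (mem_index_enum _); rewrite psumr_eq0 /=; last first.
  by move=> k _; rewrite sqr_ge0.
by move=> /allP/(_ j (mem_index_enum _))/=; rewrite mulf_eq0 orbb => /eqP.
Qed.

Lemma mip_eq0 m n (A : 'M[R]_(m, n)) : (mip A A == 0) = (A == 0).
Proof.
apply/eqP/eqP => [A0|->]; last by rewrite mip0l.
by apply: mip_le0; rewrite A0.
Qed.

Lemma mip_col m (u v : 'cV[R]_m) : (u^T *m v) 0 0 = mip u v.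
Proof. by rewrite /mip [u^T *m v]mx11_scalar mxtrace_scalar mxE. Qed.

Lemma mip_sum_cols m n (A B : 'M[R]_(m, n)) :
  mip A B = \sum_j mip (col j A) (col j B).
Proof.
rewrite mipE exchange_big; apply: eq_bigr => j _.
rewrite mipE; apply: eq_bigr => i _.
by rewrite big_ord_recl big_ord0 addr0 !mxE.
Qed.

Lemma mulmx_sum_cols m n (A : 'M[R]_(m, n)) :
  A *m A^T = \sum_j col j A *m (col j A)^T.
Proof.
apply/matrixP => i k; rewrite mxE summxE; apply: eq_bigr => j _.
by rewrite [RHS]mxE big_ord_recl big_ord0 addr0 !mxE.
Qed.

End InnerProduct.

(** * Differentiability and compactness *)

(** Stated on scalar entries, so that products of matrix-valued maps reduce to the sum and product
    rules for real functions. *)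
Definition entrywise_diff (R : realType) (V : normedModType R) (m n : nat)
    (F : V -> 'M[R]_(m, n)) : Prop :=
  forall i j x, differentiable (fun x => F x i j : R) x.

Section EntrywiseDiff.
Context {R : realType} {V : normedModType R}.

Lemma entrywise_diff_cst m n (A : 'M[R]_(m, n)) :
  entrywise_diff (fun _ : V => A).
Proof. by move=> i j x; exact: differentiable_cst. Qed.

Lemma entrywise_diffD m n (F G : V -> 'M[R]_(m, n)) :
  entrywise_diff F -> entrywise_diff G -> entrywise_diff (fun x => F x + G x).
Proof.
move=> dF dG i j x.
rewrite (_ : (fun _ => _) = (fun x => F x i j) + (fun x => G x i j)).
  exact: differentiableD.
by apply/funext => y; rewrite mxE.
Qed.

Lemma entrywise_diff_tr m n (F : V -> 'M[R]_(m, n)) :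
  entrywise_diff F -> entrywise_diff (fun x => (F x)^T).
Proof.
move=> dF i j x; rewrite (_ : (fun _ => _) = (fun x => F x j i)) //.
by apply/funext => y; rewrite mxE.
Qed.

Lemma entrywise_diffM m n p (F : V -> 'M[R]_(m, n)) (G : V -> 'M[R]_(n, p)) :
  entrywise_diff F -> entrywise_diff G ->
  entrywise_diff (fun x => F x *m G x).
Proof.
move=> dF dG i j x.
rewrite (_ : (fun _ => _) =
  \sum_k ((fun x => F x i k) * (fun x => G x k j))).
  by apply: differentiable_sum => k; exact: differentiableM.
by apply/funext => y; rewrite mxE fct_sumE.
Qed.

Lemma differentiable_mip m n (F G : V -> 'M[R]_(m, n)) :
  entrywise_diff F -> entrywise_diff G ->
  forall x, differentiable (fun x => mip (F x) (G x) : R) x.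
Proof.
move=> dF dG x.
rewrite (_ : (fun _ => _) =
  \sum_i \sum_j ((fun x => F x i j) * (fun x => G x i j))).
  apply: differentiable_sum => i; apply: differentiable_sum => j.
  exact: differentiableM.
apply/funext => y; rewrite mipE fct_sumE; apply: eq_bigr => i _.
by rewrite fct_sumE.
Qed.

End EntrywiseDiff.

Lemma entrywise_diff_id (R : realType) m n :
  entrywise_diff (fun A : 'M[R]_(m, n) => A).
Proof. by move=> i j x; exact: differentiable_coord. Qed.

Lemma entrywise_diff_vec_mx (R : realType) m n :
  entrywise_diff (fun x : 'rV[R]_(m * n) => vec_mx x).
Proof.
move=> i j x.
rewrite (_ : (fun _ => _) = (fun x : 'rV[R]_(m * n) => x 0 (mxvec_index i j))).
  exact: differentiable_coord.
by apply/funext => y; rewrite mxE.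
Qed.

(** Expanding [F x] over the matrix units makes each entry of [A (F x)] a finite linear combination
    of entries of [F x]. *)
Lemma entrywise_diff_linear (R : realType) (V : normedModType R) n m
    (A : {linear 'M[R]_n -> 'cV[R]_m}) (F : V -> 'M[R]_n) :
  entrywise_diff F -> entrywise_diff (fun x => A (F x)).
Proof.
move=> dF i j x.
rewrite (_ : (fun _ => _) =
  \sum_k \sum_l (A (delta_mx k l) i j *: (fun x => F x k l))).
  apply: differentiable_sum => k; apply: differentiable_sum => l.
  exact: differentiableZ.
apply/funext => y; rewrite [in LHS](matrix_sum_delta (F y)) linear_sum summxE.
rewrite fct_sumE; apply: eq_bigr => k _.
rewrite linear_sum summxE fct_sumE; apply: eq_bigr => l _.
by rewrite linearZ mxE mulrC.
Qed.

(** * Compactness of the set of matrices with orthonormal columns *)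

Definition isometry_mx (R : realType) (n k : nat) (U : 'M[R]_(n, k)) : Prop :=
  U^T *m U = 1%:M.

Section Compactness.
Context {R : realType}.

Lemma pid_isometry n k : (k <= n)%N -> isometry_mx (pid_mx k : 'M[R]_(n, k)).
Proof.
by move=> kn; rewrite /isometry_mx tr_pid_mx mul_pid_mx minnn (minn_idPr kn) pid_mx_1.
Qed.

(** Closed as the zero set of |U^T U - I|^2; bounded because each column has squared norm 1, so no
    entry exceeds 1 in absolute value. Matrices are flattened to row vectors to suit
    [EVT_max_rV]. *)
Lemma isometry_compact n k :
  compact [set x : 'rV[R]_(n * k) | isometry_mx (vec_mx x)]%classic.
Proof.
apply: bounded_closed_compact; last first.
  pose f (x : 'rV[R]_(n * k)) : R := mip ((vec_mx x)^T *m vec_mx x + - 1%:M)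
     ((vec_mx x)^T *m vec_mx x + - 1%:M).
  rewrite (_ : [set _ | _]%classic = (f @^-1` [set 0])%classic); last first.
    apply/seteqP; split => x /=; rewrite /f /isometry_mx.
      by move=> ->; rewrite subrr mip0l.
    by move/eqP; rewrite mip_eq0 subr_eq0 => /eqP.
  apply: closed_comp; last exact: closed_eq.
  move=> x _; apply: (@differentiable_continuous _ _ R^o).
  have dU : entrywise_diff (fun x : 'rV[R]_(n * k) => (vec_mx x)^T *m vec_mx x + - 1%:M).
    apply: entrywise_diffD; last exact: entrywise_diff_cst.
    apply: entrywise_diffM; last exact: entrywise_diff_vec_mx.
    by apply: entrywise_diff_tr; exact: entrywise_diff_vec_mx.
  exact: differentiable_mip.
exists 1; split=> // M M1 x /= xU.
rewrite /Num.norm/= mx_normrE; apply: bigmax_le => [|[i j] _ /=].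
  exact: le_trans (ltW M1).
apply: le_trans (ltW M1).
rewrite -(vec_mxK x); case/mxvec_indexP: j => a b.
rewrite ord1 mxvecE.
have U1 : ((vec_mx x)^T *m vec_mx x) b b = 1 by rewrite xU mxE eqxx.
rewrite -(ler_pXn2r (_ : (0 < 2)%N)) ?nnegrE// expr1n real_normK ?num_real// -U1.
rewrite [leRHS]mxE (bigD1 a) //= [X in X * _]mxE expr2 lerDl; apply: sumr_ge0 => c _.
by rewrite !mxE -expr2 sqr_ge0.
Qed.

Lemma isometry_max n k (f : 'M[R]_(n, k) -> R) : (k <= n)%N ->
  (forall x, {for x, continuous (fun x : 'rV[R]_(n * k) => f (vec_mx x) : R)}) ->
  exists2 U, isometry_mx U & forall W, isometry_mx W -> f W <= f U.
Proof.
move=> kn cf.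
have [||c] := EVT_max_rV (f := fun x => f (vec_mx x)) _ (@isometry_compact n k) _.
- by exists (mxvec (pid_mx k)); rewrite /= mxvecK; exact: pid_isometry.
- by apply: continuous_subspaceT => x; exact: cf.
rewrite inE /= => cU cmax; exists (vec_mx c) => // W WU.
by have := cmax (mxvec W); rewrite mxvecK; apply; rewrite inE /= mxvecK.
Qed.

End Compactness.

(** * Polar decomposition and factorizations *)

Section Polar.
Context {R : realType}.

(** Rodrigues' rotation formula with sine s and cosine c: the product collapses to W^T W = I + (1 -
    s^2 - c^2) K^2. *)
Lemma rotation_isometry n (K : 'M[R]_n) (s c : R) :
  K^T = - K -> K *m K *m K = - K -> s ^+ 2 + c ^+ 2 = 1 ->
  isometry_mx (1%:M + s *: K + (1 - c) *: (K *m K)).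
Proof.
move=> KT K3 sc1; rewrite /isometry_mx.
have [L LE] : exists L, K *m K = L by exists (K *m K).
have LT : L^T = L by rewrite -LE trmx_mul KT mulmxN mulNmx opprK.
have KL : K *m L = - K by rewrite -LE mulmxA.
have LK : L *m K = - K by rewrite -LE.
have LL : L *m L = - L by rewrite -{1}LE -mulmxA KL mulmxN LE.
rewrite LE !linearD !linearZ /= trmx1 LT KT scalerN.
rewrite !(mulmxDl, mulmxDr, mul1mx, mulmx1, mulNmx, mulmxN).
rewrite -!(scalemxAl, scalemxAr) LL KL LK LE.
apply/matrixP => i j; rewrite !mxE; move: (_%:R) => d.
apply/eqP; rewrite -subr_eq0; apply/eqP.
transitivity ((1 - (s ^+ 2 + c ^+ 2)) * L i j); first by ring.
by rewrite sc1 subrr mul0r.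
Qed.

Lemma mip_delta m n (A : 'M[R]_(m, n)) i j : mip (delta_mx i j) A = A i j.
Proof.
rewrite mipE (bigD1 i) //= (bigD1 j) //= !mxE !eqxx mul1r.
rewrite big1 ?addr0 => [|l /negPf lj]; last by rewrite mxE eqxx lj mul0r.
rewrite big1 ?addr0 // => l /negPf li.
by rewrite big1 // => p _; rewrite mxE li mul0r.
Qed.

(** The identity is stationary along the rotations of each coordinate plane (i, j), and the
    derivative there is a multiple of N_ij - N_ji. *)
Lemma rotation_max_sym n (N : 'M[R]_n) :
  (forall W : 'M[R]_n, isometry_mx W -> mip W N <= mip 1%:M N) -> N^T = N.
Proof.
move=> Nmax; apply/matrixP => i j; rewrite mxE.
have [->//|ij] := eqVneq i j.
pose K : 'M[R]_n := delta_mx i j - delta_mx j i.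
have ji : j != i by rewrite eq_sym.
have KT : K^T = - K by rewrite /K linearB /= !trmx_delta opprB.
have KK : K *m K = - (delta_mx i i + delta_mx j j).
  rewrite /K mulmxBl !mulmxBr !mul_delta_mx !mul_delta_mx_0 //.
  by rewrite sub0r subr0 opprD.
have K3 : K *m K *m K = - K.
  rewrite KK mulNmx /K mulmxDl !mulmxBr !mul_delta_mx !mul_delta_mx_0 //.
  by rewrite subr0 sub0r.
have mK : mip K N = N i j - N j i by rewrite mipDl mipNl !mip_delta.
have mKK : mip (K *m K) N = - (N i i + N j j).
  by rewrite KK mipNl mipDl !mip_delta.
clear KK; clearbody K.
(* Rational parametrization of the circle: sine 2t / (1 + t^2), cosine (1 - t^2) / (1 + t^2). *)
have key t : t * (N i j - N j i) <= t ^+ 2 * (N i i + N j j).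
  have t0 : 0 < 1 + t ^+ 2 by have := sqr_ge0 t; lra.
  have tN0 : 1 + t ^+ 2 != 0 by rewrite gt_eqF.
  have sc : (2 * t / (1 + t ^+ 2)) ^+ 2 + ((1 - t ^+ 2) / (1 + t ^+ 2)) ^+ 2 = 1.
    by field.
  have := Nmax _ (rotation_isometry KT K3 sc).
  rewrite !(mipDl, mipZl) mK mKK -subr_ge0 => H.
  have : 0 <= (1 + t ^+ 2) / 2 * (t ^+ 2 * 2 / (1 + t ^+ 2) * (N i i + N j j)
      - 2 * t / (1 + t ^+ 2) * (N i j - N j i)).
    apply: mulr_ge0; first lra.
    by apply: le_trans H _; rewrite le_eqVlt; apply/orP; left; apply/eqP; field.
  rewrite (_ : _ * _ = t ^+ 2 * (N i i + N j j) - t * (N i j - N j i)) ?subr_ge0 //.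
  by field.
move: key; set d := N i j - N j i; set e := N i i + N j j => key.
suff d0 : d = 0 by apply/esym/eqP; rewrite -subr_eq0; apply/eqP.
(* For this t, [key] reads t^2 (1 + |e|) <= t^2 e, which forces t = 0 and hence d = 0. *)
pose t := d / (1 + `|e|).
have e0 : 0 < 1 + `|e| by have := normr_ge0 e; lra.
have dE : d = t * (1 + `|e|) by rewrite /t mulfVK ?gt_eqF.
have := key t; rewrite {1}dE => H.
have H' : t ^+ 2 * e <= t ^+ 2 * `|e| by apply: ler_wpM2l; rewrite ?sqr_ge0 ?ler_norm.
have t2 : t ^+ 2 <= 0 by nra.
have : t ^+ 2 == 0 by rewrite eq_le t2 sqr_ge0.
by rewrite sqrf_eq0 => /eqP t00; rewrite dE t00 mul0r.
Qed.

(* The isometry maximizing [<U, Z>] works: no rotation [W] can make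
   [<W U, Z>] larger, so [Z U^T] is symmetric. *)
Lemma polar_decomposition n k (Z : 'M[R]_(n, k)) : (k <= n)%N ->
  exists U P, [/\ isometry_mx U, P^T = P & Z = U *m P].
Proof.
move=> kn.
have [|U UU Umax] := @isometry_max R n k (fun U => mip U Z) kn.
  move=> x; apply: (@differentiable_continuous _ _ R^o).
  apply: differentiable_mip; last exact: entrywise_diff_cst.
  exact: entrywise_diff_vec_mx.
have ZUT : (Z *m U^T)^T = Z *m U^T.
  apply: rotation_max_sym => W WW.
  have -> : mip W (Z *m U^T) = mip (W *m U) Z by rewrite mip_mulr.
  rewrite -mip_mulr mul1mx; apply: Umax.
  by rewrite /isometry_mx trmx_mul mulmxA -(mulmxA U^T) WW mulmx1.
have ZE : Z = U *m (Z^T *m U).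
  by rewrite mulmxA -{1}[U]trmxK -trmx_mul ZUT -mulmxA UU mulmx1.
exists U, (Z^T *m U); split=> //.
by rewrite trmx_mul trmxK {2}ZE trmx_mul -mulmxA UU mulmx1 trmx_mul trmxK.
Qed.

(** A least right singular vector: the unit sphere is the set of one-column isometries, so a
    minimizer of |X u|^2 exists there, and homogeneity extends the bound to every v. *)
Lemma min_gain n r (X : 'M[R]_(n, r)) : (0 < r)%N ->
  exists2 u : 'cV[R]_r, mip u u = 1 &
    forall v : 'cV[R]_r, mip (X *m u) (X *m u) * mip v v <= mip (X *m v) (X *m v).
Proof.
move=> r0.
have [|u uu umax] := @isometry_max R r 1 (fun u => - mip (X *m u) (X *m u)) r0.
  move=> x; apply: (@differentiable_continuous _ _ R^o).
  have dX : entrywise_diff (fun x : 'rV[R]_(r * 1) => X *m vec_mx x).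
    apply: entrywise_diffM; first exact: entrywise_diff_cst.
    exact: entrywise_diff_vec_mx.
  apply: (@differentiableN R _ R^o (fun x : 'rV[R]_(r * 1) => mip _ _)).
  exact: differentiable_mip.
exists u => [|v]; first by rewrite /mip uu mxtrace1.
have [->|v0] := eqVneq v 0; first by rewrite mulmx0 !mip0l mulr0.
have v1 : 0 < mip v v by rewrite lt_neqAle eq_sym mip_eq0 v0 mip_ge0.
pose a := (Num.sqrt (mip v v))^-1.
have aa : a ^+ 2 * mip v v = 1.
  by rewrite exprVn sqr_sqrtr ?mip_ge0 // mulVf ?gt_eqF.
have avU : isometry_mx (a *: v).
  by apply/matrixP => i j; rewrite !ord1 mip_col !mip_lin mulrA -expr2 aa mxE eqxx.
have := umax _ avU; rewrite lerN2 -scalemxAr !mip_lin mulrA -expr2 => H.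
rewrite -(ler_pM2l (_ : 0 < a ^+ 2)); last first.
  by rewrite exprn_gt0 // invr_gt0 sqrtr_gt0.
by rewrite mulrCA aa mulr1.
Qed.

(** Induction by pivoting: with w = M v and d = <v, M v> > 0, subtracting w w^T / d keeps the matrix
    positive semidefinite and lowers its rank. *)
Lemma psd_factor n k (M : 'M[R]_n) : psd M -> (\rank M <= k)%N ->
  exists Z : 'M[R]_(n, k), M = Z *m Z^T.
Proof.
elim: k M => [|k IHk] M [MT M0] rM.
  by exists 0; rewrite mul0mx; apply/eqP; rewrite -mxrank_eq0 -leqn0.
have qE (v : 'cV_n) : (v^T *m M *m v) 0 0 = mip v (M *m v).
  by rewrite -mulmxA mip_col.
have symM (u v : 'cV_n) : mip u (M *m v) = mip v (M *m u) by rewrite mipC mip_mull MT.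
have [[v vMv]|noV] := pselect (exists v : 'cV_n, mip v (M *m v) != 0); last first.
  exists 0; rewrite mul0mx.
  have {}noV (v : 'cV_n) : mip v (M *m v) = 0.
    by apply: contrapT => /eqP v0; apply: noV; exists v.
  have Mv0 (v : 'cV_n) : M *m v = 0.
    apply/eqP; rewrite -mip_eq0; apply/eqP.
    (* If the quadratic form vanishes identically, its value at v + M v is 2 |M v|^2, so M v = 0. *)
    have := noV (v + M *m v); rewrite mulmxDr !mip_lin !noV (symM v (M *m v)).
    by clear; lra.
  apply/matrixP => i j; rewrite mxE.
  by have := congr1 (fun w : 'cV_n => w i 0) (Mv0 (delta_mx j 0)); rewrite -colE !mxE.
set d := mip v (M *m v) in vMv *.
have d0 : 0 < d by rewrite lt_neqAle eq_sym vMv /d -qE M0.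
pose w := M *m v.
pose M' := M - d^-1 *: (w *m w^T).
have M'v : M' *m v = 0.
  rewrite mulmxBl -scalemxAl -mulmxA [w^T *m v]mx11_scalar mip_col mipC -/d.
  by rewrite mul_mx_scalar scalerA mulVf // scale1r subrr.
have psdM' : psd M'.
  split=> [|u]; first by rewrite linearB linearZ /= MT trmx_mul trmxK.
  rewrite -mulmxA mip_col mulmxBl -scalemxAl -mulmxA.
  rewrite [w^T *m u]mx11_scalar mip_col mul_mx_scalar !mip_lin.
  set t := mip w u; rewrite [mip u w]mipC -/t.
  (* The form of [M'] at u equals the form of [M] at u - (t / d) v. *)
  have := M0 (u - (t / d) *: v); rewrite qE mulmxBr -scalemxAr !mip_lin.
  rewrite (symM v u) -/w [mip u w]mipC -/t -/d => H.
  apply: le_trans H _; rewrite le_eqVlt; apply/orP; left; apply/eqP.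
  by field.
(* The row space of [M'] lies in that of [M]; equal ranks would give M = Y M', hence M v = Y M' v =
   0, against d > 0. *)
have rM' : (\rank M' <= k)%N.
  rewrite -ltnS; apply: leq_trans rM; rewrite ltn_neqAle.
  have M'E : M' = (1%:M - d^-1 *: (w *m v^T)) *m M.
    by rewrite mulmxBl mul1mx -scalemxAl -mulmxA /M' /w trmx_mul MT.
  have sM : (M' <= M)%MS by rewrite M'E submxMl.
  rewrite mxrankS // andbT; apply/negP => /eqP rE.
  have /submxP[Y ME] : (M <= M')%MS by rewrite -(geq_leqif (mxrank_leqif_sup sM)) rE.
  by move: vMv; rewrite /d ME -mulmxA M'v mulmx0 mip0r eqxx.
have [Z' ZE] := IHk _ psdM' rM'.
have ZZ : row_mx ((Num.sqrt d)^-1 *: w) Z' *m (row_mx ((Num.sqrt d)^-1 *: w) Z')^T = M.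
  rewrite tr_row_mx mul_row_col -ZE linearZ /= -scalemxAl -scalemxAr scalerA.
  by rewrite -invfM -expr2 sqr_sqrtr ?ltW // addrC subrK.
by exists (row_mx ((Num.sqrt d)^-1 *: w) Z').
Qed.

End Polar.

(** * Derivatives of the objective *)

Section Derivatives.
Context {R : realType}.

(** The objective and its directional derivatives are polynomials along every line, so both
    derivatives are read off as p'(0). *)
Lemma derive_along_line (V : normedModType R) (f : V -> R) (a v : V) (p : {poly R}) :
  (forall h, f (h *: v + a) = p.[h]) ->
  derivable f a v /\ 'D_v f a = p^`().[0].
Proof.
move=> fp; have fE : f \o shift a \o *:%R^~ v = horner p.
  by apply/funext => h /=; rewrite fp.
have dE : (fun h : R => h^-1 *: ((f \o shift a) (h *: v) - f a)) =
          (fun h : R => h^-1 *: ((horner p \o shift 0) (h *: 1) - p.[0])).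
  apply/funext => h /=; rewrite -(fp 0) scale0r add0r addr0.
  by rewrite [h *: 1]mulr1 fp.
split.
  rewrite /derivable dE; exact: (@derivable_horner _ p 0).
by rewrite /derive dE -[lim _]/('D_1 (horner p) 0) -derive1E derivE.
Qed.

Section Objective.
Context {n r m : nat} (A : {linear 'M[R]_n -> 'cV[R]_m}) (b : 'cV[R]_m).

Local Notation f := (@fA R n r m A b).
Local Notation res X := (A (X *m X^T) - b).
Local Notation dA X V := (A (X *m V^T + V *m X^T)).

Lemma fA_differentiable X : differentiable f X.
Proof.
rewrite (_ : f = fun X => mip (A (X *m X^T) + - b) (A (X *m X^T) + - b)).
  have dE : entrywise_diff (fun X : 'M[R]_(n, r) => A (X *m X^T) + - b).
    apply: entrywise_diffD; last exact: entrywise_diff_cst.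
    apply: entrywise_diff_linear; apply: entrywise_diffM.
      exact: entrywise_diff_id.
    by apply: entrywise_diff_tr; exact: entrywise_diff_id.
  exact: (differentiable_mip dE dE).
by apply/funext => X'; rewrite /fA sqnormE.
Qed.

Lemma res_line (X V : 'M[R]_(n, r)) h :
  res (h *: V + X) = res X + h *: dA X V + h ^+ 2 *: A (V *m V^T).
Proof.
have -> : (h *: V + X) *m (h *: V + X)^T =
    X *m X^T + (h *: (X *m V^T + V *m X^T) + h ^+ 2 *: (V *m V^T)).
  rewrite linearD linearZ /= mulmxDl !mulmxDr -!scalemxAl -!scalemxAr scalerA.
  move: (X *m X^T) (X *m V^T) (V *m X^T) (V *m V^T) => XX XV VX VV.
  by apply/matrixP => i j; rewrite !mxE; ring.
by rewrite linearD [A (h *: _ + _)]linearD !linearZ /= addrAC !addrA.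
Qed.

Lemma fA_derive (X V : 'M[R]_(n, r)) : 'D_V f X = 2 * mip (res X) (dA X V).
Proof.
set E := res X; set B := dA X V; set C := A (V *m V^T).
(* The quartic is the expansion of |E + h B + h^2 C|^2. *)
have [|_ ->] := @derive_along_line _ f X V
  ((mip E E)%:P + (2 * mip E B)%:P * 'X + (mip B B + 2 * mip E C)%:P * 'X^2
   + (2 * mip B C)%:P * 'X^3 + (mip C C)%:P * 'X^4).
  move=> h; rewrite /fA sqnormE res_line -/E -/B -/C.
  rewrite !(hornerD, hornerM, hornerC, hornerX, hornerXn).
  clearbody E B C; rewrite !mip_lin.
  by rewrite (mipC B E) (mipC C E) (mipC C B); ring.
rewrite !(derivD, derivM, derivC, derivX, derivXn).
by rewrite !(hornerD, hornerM, hornerMn, hornerC, hornerX, hornerXn); ring.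
Qed.

Lemma fA_derive2 (X V : 'M[R]_(n, r)) :
  derivable (fun Y => 'D_V f Y) X V /\
  'D_V (fun Y => 'D_V f Y) X =
    2 * (mip (dA X V) (dA X V) + 2 * mip (res X) (A (V *m V^T))).
Proof.
set E := res X; set B := dA X V; set C := A (V *m V^T).
(* The cubic is the expansion of 2 <E + h B + h^2 C, B + 2 h C>. *)
have [|d ->] := @derive_along_line _ (fun Y => 'D_V f Y) X V
  ((2 * mip E B)%:P + (2 * (mip B B + 2 * mip E C))%:P * 'X
   + (6 * mip B C)%:P * 'X^2 + (4 * mip C C)%:P * 'X^3).
  move=> h; rewrite fA_derive res_line -/E -/B -/C.
  have -> : dA (h *: V + X) V = B + (2 * h) *: C.
    rewrite /B /C -linearZ -linearD; congr (A _).
    rewrite linearD linearZ /= mulmxDl mulmxDr -!scalemxAl -!scalemxAr.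
    by rewrite addrACA -scalerDl addrC mulr_natl mulr2n.
  rewrite !(hornerD, hornerM, hornerC, hornerX, hornerXn).
  clearbody E B C; rewrite !mip_lin.
  by rewrite (mipC C B); ring.
split=> //; rewrite !(derivD, derivM, derivC, derivX, derivXn).
by rewrite !(hornerD, hornerM, hornerMn, hornerC, hornerX, hornerXn); ring.
Qed.

Lemma fA_grad_zero (X : 'M[R]_(n, r)) :
  grad_zero f X <-> forall V : 'M[R]_(n, r), mip (res X) (dA X V) = 0.
Proof.
have df := fA_differentiable X.
split=> [[_ dX0] V|dX0]; last split=> // V.
  have := dX0 V; rewrite -deriveE // fA_derive => /eqP.
  by rewrite mulf_eq0 pnatr_eq0 => /eqP.
by rewrite -deriveE // fA_derive dX0 mulr0.
Qed.

Lemma fA_hess_psd (X : 'M[R]_(n, r)) :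
  hess_psd f X <->
  forall V : 'M[R]_(n, r), 0 <= mip (dA X V) (dA X V) + 2 * mip (res X) (A (V *m V^T)).
Proof.
split=> H V; have [d dE] := fA_derive2 X V; last first.
  by split=> //; rewrite dE mulr_ge0.
by have [_] := H V; rewrite dE pmulr_rge0.
Qed.

End Objective.
End Derivatives.

(** * The tangent-normal inequality *)

Section KeyInequality.
Context {R : realType}.

Lemma mip_isometry n k p (Q : 'M[R]_(n, k)) (A B : 'M[R]_(k, p)) :
  isometry_mx Q -> mip (Q *m A) (Q *m B) = mip A B.
Proof. by move=> QQ; rewrite mip_mull mulmxA QQ mul1mx. Qed.

Lemma mip_gram m n (A : 'M[R]_(m, n)) :
  mip (A *m A^T) (A *m A^T) = mip (A^T *m A) (A^T *m A).
Proof. by rewrite [LHS]mip_mulr [RHS]mip_mull !trmxK mulmxA. Qed.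

Lemma mip_cross_gram m n k (A : 'M[R]_(m, k)) (B : 'M[R]_(n, k)) :
  mip (A *m B^T) (A *m B^T) = mip (A^T *m A) (B^T *m B).
Proof. by rewrite [LHS]mip_mulr [RHS]mip_mull !trmxK mulmxA. Qed.

Lemma mip1_gram m n (A : 'M[R]_(m, n)) : mip 1%:M (A^T *m A) = mip A A.
Proof. by rewrite -mip_mull mulmx1. Qed.

Lemma gain_mul m n p (P : 'M[R]_(m, n)) (Y : 'M[R]_(n, p)) s :
  (forall v : 'cV[R]_n, s * mip v v <= mip (P *m v) (P *m v)) ->
  s * mip Y Y <= mip (P *m Y) (P *m Y).
Proof.
move=> Ps; rewrite !mip_sum_cols mulr_sumr; apply: ler_sum => j _.
by rewrite [col j (P *m Y)]colE -mulmxA -colE; exact: Ps.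
Qed.

(** Expansion of |D - B|^2 >= 0 for the test matrix B = s F + t U G U^T, where U is the polar factor
    of Z1 and F projects onto the complement of its range. Both parts of B are positive
    semidefinite, so P^2 pairs with them to at least s times their traces. *)
Lemma residual_bound r k (P : 'M[R]_r) (Z1 : 'M[R]_(r, k)) (G : 'M[R]_k)
    (p : nat) (Zp : 'M[R]_(p, k)) (s t : R) : (k <= r)%N -> 0 <= s -> 0 <= t ->
  P^T = P -> (forall v : 'cV[R]_r, s * mip v v <= mip (P *m v) (P *m v)) ->
  G = Zp^T *m Zp ->
  s ^+ 2 * (r%:R - k%:R) + 2 * s * t * mip Zp Zp - t ^+ 2 * mip G G
    - 2 * t * mip (Z1^T *m Z1) G <=
  mip (P *m P - Z1 *m Z1^T) (P *m P - Z1 *m Z1^T).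
Proof.
move=> kr s0 t0 PT Ps GE; set D := P *m P - Z1 *m Z1^T.
(* With Z1 = U P', conjugation by U carries Z1^T Z1 to Z1 Z1^T; hence <Z1 Z1^T, U G U^T> = <Z1^T Z1,
   G>, while F annihilates Z1. *)
have [U [P' [UU P'T Z1E]]] := polar_decomposition Z1 kr.
pose F := 1%:M - U *m U^T.
have FU : F *m U = 0 by rewrite mulmxBl mul1mx -mulmxA UU mulmx1 subrr.
have FT : F^T = F by rewrite linearB /= trmx1 trmx_mul trmxK.
have FF : F *m F = F by rewrite {2}/F mulmxBr mulmx1 mulmxA FU mul0mx subr0.
have GT : G^T = G by rewrite GE trmx_mul trmxK.
have UTF : U^T *m F = 0 by rewrite -[U^T *m F]trmxK trmx_mul trmxK FT FU trmx0.
have mFF : mip F F = r%:R - k%:R.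
  by rewrite /mip FT FF linearB /= mxtrace1 mxtrace_mulC UU mxtrace1.
pose T := U *m G *m U^T.
have mUU (M N : 'M[R]_k) : mip (U *m M *m U^T) (U *m N *m U^T) = mip M N.
  by rewrite mip_mulr trmxK -!mulmxA UU mulmx1 mip_isometry.
have mFT : mip F T = 0 by rewrite /T -mulmxA mipC mip_mull UTF mip0r.
have mPP p' (Y : 'M[R]_(r, p')) : mip (P *m P) (Y *m Y^T) = mip (P *m Y) (P *m Y).
  by rewrite mip_mull PT [RHS]mip_mulr -mulmxA.
have mTT : mip T T = mip G G by exact: mUU.
have PPF : s * (r%:R - k%:R) <= mip (P *m P) F.
  have -> : mip (P *m P) F = mip (P *m F) (P *m F) by rewrite -mPP FT FF.
  by rewrite -mFF gain_mul.
have PPT : s * mip Zp Zp <= mip (P *m P) T.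
  have -> : T = (U *m Zp^T) *m (U *m Zp^T)^T.
    by rewrite trmx_mul trmxK /T GE !mulmxA.
  by rewrite mPP -(mip_tr Zp Zp) -(mip_isometry Zp^T Zp^T UU) gain_mul.
have ZF : mip (Z1 *m Z1^T) F = 0.
  by rewrite mip_mull Z1E trmx_mul -mulmxA UTF mulmx0 mip0r.
have ZT : mip (Z1 *m Z1^T) T = mip (Z1^T *m Z1) G.
  rewrite Z1E trmx_mul P'T [in RHS]mulmxA -(mulmxA P' U^T) UU mulmx1.
  by rewrite -(mUU _ G) !mulmxA.
clearbody F T.
pose B := s *: F + t *: T.
have : 0 <= mip (D - B) (D - B) by exact: mip_ge0.
have -> : mip (D - B) (D - B) = mip D D - 2 * mip D B + mip B B.
  by clearbody B D; rewrite !mip_lin (mipC B D); ring.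
have -> : mip B B = s ^+ 2 * (r%:R - k%:R) + t ^+ 2 * mip G G.
  by rewrite /B -mFF -mTT !mip_lin (mipC T F) mFT; ring.
have -> : mip D B = s * mip (P *m P) F + t * mip (P *m P) T - t * mip (Z1^T *m Z1) G.
  by rewrite /D /B mipDl mipNl !mipDr !mipZr ZF ZT; ring.
have := ler_wpM2l s0 PPF; have := ler_wpM2l t0 PPT.
clear; move: (mip (P *m P) F) (mip (P *m P) T) (mip D D) => x y d.
move: (mip Zp Zp) (mip G G) (mip _ G) => z g w.
by lra.
Qed.

(** In the splitting given by Q and its complement, this is the residual with its normal block - W
    W^T removed, for Z = Q A + W; [D] is the block on the range of Q. *)
Definition tangent_part n r k (Q : 'M[R]_(n, r)) (D : 'M[R]_r)
    (A : 'M[R]_(r, k)) (W : 'M[R]_(n, k)) : 'M[R]_n :=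
  Q *m D *m Q^T - Q *m A *m W^T - W *m A^T *m Q^T.

Lemma tangent_partE n r k (Q : 'M[R]_(n, r)) (S : 'M[R]_r)
    (A : 'M[R]_(r, k)) (W : 'M[R]_(n, k)) :
  Q *m S *m Q^T - (Q *m A + W) *m (Q *m A + W)^T =
  tangent_part Q (S - A *m A^T) A W - W *m W^T.
Proof.
rewrite /tangent_part linearD /= trmx_mul mulmxBr mulmxBl mulmxDl 2!mulmxDr.
rewrite !mulmxA.
move: (Q *m S *m _) (Q *m A *m A^T *m _) (Q *m A *m W^T) (W *m A^T *m _) (W *m W^T).
by move=> B C F H L; apply/matrixP => i j; rewrite !mxE; ring.
Qed.

Lemma tangent_part_sym n r k (Q : 'M[R]_(n, r)) (D : 'M[R]_r)
    (A : 'M[R]_(r, k)) (W : 'M[R]_(n, k)) : D^T = D ->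
  exists Y, tangent_part Q D A W = Q *m Y^T + Y *m Q^T.
Proof.
move=> DT; exists (2^-1 *: (Q *m D) - W *m A^T).
rewrite /tangent_part linearB linearZ /= !trmx_mul trmxK DT.
rewrite mulmxBr mulmxBl -scalemxAr -scalemxAl !mulmxA.
move: (Q *m D *m _) (Q *m A *m _) (W *m _ *m _) => B C F.
by apply/matrixP => i j; rewrite !mxE; field.
Qed.

Section TangentNormal.
Context {n r k : nat} (Q : 'M[R]_(n, r)) (D : 'M[R]_r).
Context (A : 'M[R]_(r, k)) (W : 'M[R]_(n, k)).
Hypotheses (QQ : isometry_mx Q) (QW : Q^T *m W = 0).

(** Q^T W = 0 makes the three blocks pairwise orthogonal, and the two off-diagonal ones are
    transposes of each other. *)
Lemma mip_tangent_part :
  mip (tangent_part Q D A W) (tangent_part Q D A W) =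
  mip D D + 2 * mip (A^T *m A) (W^T *m W).
Proof.
have WQ : W^T *m Q = 0 by rewrite -[_ *m Q]trmxK trmx_mul trmxK QW trmx0.
have mDD : mip (Q *m D *m Q^T) (Q *m D *m Q^T) = mip D D.
  by rewrite mip_mulr trmxK -!mulmxA QQ mulmx1 mip_isometry.
have mDA : mip (Q *m D *m Q^T) (Q *m A *m W^T) = 0.
  by rewrite mip_mulr trmxK -!mulmxA WQ !mulmx0 mip0r.
have mDW : mip (Q *m D *m Q^T) (W *m A^T *m Q^T) = 0.
  by rewrite -!mulmxA mip_mull mulmxA QW mul0mx mip0r.
have mAW : mip (Q *m A *m W^T) (W *m A^T *m Q^T) = 0.
  by rewrite -!mulmxA mip_mull mulmxA QW mul0mx mip0r.
have mAA : mip (Q *m A *m W^T) (Q *m A *m W^T) = mip (A^T *m A) (W^T *m W).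
  by rewrite -!mulmxA mip_isometry // mip_cross_gram.
have mWW : mip (W *m A^T *m Q^T) (W *m A^T *m Q^T) = mip (A^T *m A) (W^T *m W).
  by rewrite -mAA -mip_tr !trmx_mul !trmxK mulmxA.
rewrite /tangent_part; move: mDD mDA mDW mAW mAA mWW.
move: (Q *m D *m Q^T) (Q *m A *m W^T) (W *m A^T *m Q^T) => B C F.
move=> mDD mDA mDW mAW mAA mWW; rewrite !mip_lin (mipC C B) (mipC F B) (mipC F C).
by rewrite mDD mDA mDW mAW mAA mWW; ring.
Qed.

Lemma mip_tangent_normal : mip (tangent_part Q D A W) (W *m W^T) = 0.
Proof.
have WQ : W^T *m Q = 0 by rewrite -[_ *m Q]trmxK trmx_mul trmxK QW trmx0.
rewrite /tangent_part !mipDl !mipNl -!mulmxA.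
rewrite !(mip_mull Q) !(mulmxA Q^T) QW !mul0mx !mip0r.
by rewrite mulmxA mip_mulr trmxK -mulmxA WQ mulmx0 mip0r; ring.
Qed.

(* The test matrix of [residual_bound] is taken with [t = 1 / (1 + q)],
   [q = sqrt (r / k)]; what remains is [|(1 + q) s I - W^T W|^2 >= 0]. *)
Lemma tangent_normal_bound (P : 'M[R]_r) (s q : R) :
  (k <= r)%N -> 0 <= s -> 1 <= q -> r%:R = q ^+ 2 * k%:R -> P^T = P ->
  (forall v : 'cV[R]_r, s * mip v v <= mip (P *m v) (P *m v)) ->
  D = P *m P - A *m A^T ->
  2 * q ^+ 2 * (1 + q) * s * mip W W <=
  (1 + q) ^+ 2 * mip (tangent_part Q D A W) (tangent_part Q D A W)
    + q ^+ 2 * mip (W *m W^T) (W *m W^T).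
Proof.
move=> kr s0 q1 rE PT Ps DE; rewrite mip_tangent_part mip_gram.
have q1' : 0 < 1 + q by lra.
have t0 : 0 <= (1 + q)^-1 by rewrite invr_ge0 ltW.
have := residual_bound A kr s0 t0 PT Ps (erefl (W^T *m W)).
rewrite -DE rE.
have K0 : 0 <= mip (A^T *m A) (W^T *m W).
  by rewrite -mip_cross_gram mip_ge0.
have : 0 <= mip (((1 + q) * s)%:M - W^T *m W) (((1 + q) * s)%:M - W^T *m W).
  exact: mip_ge0.
rewrite -[_%:M]scalemx1 mipDl !mipDr !mipNl !mipNr !mipZl !mipZr.
rewrite (mipC (_ *m _) 1%:M) mip1_gram {1}/mip trmx1 mulmx1 mxtrace1.
move: (mip D D) (mip (_ *m _) (_ *m _)) (mip W W) K0 => d x y.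
move: (mip (_ *m _) (_ *m _)) (k%:R : R) => g k' x0 H1 H2.
have /(ler_wpM2l (sqr_ge0 (1 + q))) := H2.
rewrite (_ : _ * (_ - _) = s ^+ 2 * k' * (q ^+ 2 - 1) * (1 + q) ^+ 2
   + 2 * s * (1 + q) * y - g - 2 * (1 + q) * x); last by field; rewrite gt_eqF.
have q2 : 0 <= q ^+ 2 - 1 by nra.
have := mulr_ge0 q2 H1; have : 0 <= q * (1 + q) * x by nra.
by nra.
Qed.
End TangentNormal.
End KeyInequality.

(** * Exact recovery below the threshold *)

Section RIPTheory.
Context {R : realType} {n m : nat} (A : {linear 'M[R]_n -> 'cV[R]_m}).

Lemma RIP_monotone (d d' : R) p : RIP A d p -> d <= d' -> d' < 1 -> RIP A d' p.
Proof.
move=> [d0 [_ [nu [nu0 H]]]] dd' d'1; split; first exact: le_trans dd'.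
split=> //; exists nu; split=> // E /H [H1 H2].
have F0 : 0 <= frob2 E by rewrite frob2E mip_ge0.
by split; [apply: le_trans H1|apply: (le_trans H2)]; apply: ler_wpM2r; lra.
Qed.

(** Polarization: subtract the upper RIP bound at E - d T from the lower one at E + d T, and divide
    by 4 d. *)
Lemma RIP_cross (d nu : R) p : 0 < d -> 0 < nu ->
  (forall E : 'M[R]_n, (\rank E <= p)%N ->
    (1 - d) * frob2 E <= sqnorm (A E) / nu /\
    sqnorm (A E) / nu <= (1 + d) * frob2 E) ->
  forall E T : 'M[R]_n, (\rank (E + d *: T)%R <= p)%N ->
  (\rank (E - d *: T)%R <= p)%N ->
  mip E T - (mip E E + d ^+ 2 * mip T T) / 2 <= mip (A E) (A T) / nu.
Proof.
move=> d0 nu0 H E T /H[Hp _] /H[_ Hm].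
rewrite frob2E sqnormE linearD linearZ /= !mip_lin in Hp.
rewrite frob2E sqnormE linearB linearZ /= !mip_lin in Hm.
move: Hp Hm; rewrite (mipC T E) (mipC (A T) (A E)).
move: (mip E E) (mip E T) (mip T T) (mip (A E) (A E)) (mip (A E) (A T)) (mip (A T) (A T)).
move=> a b c a' b' c' Hp Hm.
have : 0 <= (4 * d) * (b' / nu - (b - (a + d ^+ 2 * c) / 2)).
  rewrite [leRHS](_ : _ =
    (a' + d * b' + (d * b' + d * (d * c'))) / nu -
      (1 - d) * (a + d * b + (d * b + d * (d * c))) -
    ((a' - d * b' + (- (d * b') - - (d * (d * c')))) / nu -
      (1 + d) * (a - d * b + (- (d * b) - - (d * (d * c)))))); first by lra.
  by field; rewrite gt_eqF.
have d4 : 0 < 4 * d by rewrite mulr_gt0.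
by rewrite (pmulr_rge0 _ d4) subr_ge0.
Qed.

End RIPTheory.

Section ColumnSpan.
Context {R : realType} {n r k : nat} (X : 'M[R]_(n, r)) (Z : 'M[R]_(n, k)).

(** Every matrix to which the RIP is applied has this form, which bounds its rank by r + k. *)
Definition col_span (E : 'M[R]_n) : Prop :=
  exists Y1 Y2, E = X *m Y1 + Z *m Y2.

Lemma col_span_rank E : col_span E -> (\rank E <= r + k)%N.
Proof.
move=> [Y1 [Y2 ->]]; apply: leq_trans (mxrank_add _ _) _.
by apply: leq_add; apply: leq_trans (mxrankM_maxl _ _) (rank_leq_col _).
Qed.

Lemma col_span_l Y : col_span (X *m Y).
Proof. by exists Y, 0; rewrite mulmx0 addr0. Qed.

Lemma col_span_r Y : col_span (Z *m Y).
Proof. by exists 0, Y; rewrite mulmx0 add0r. Qed.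

Lemma col_spanD E F : col_span E -> col_span F -> col_span (E + F).
Proof.
move=> [Y1 [Y2 ->]] [Y3 [Y4 ->]]; exists (Y1 + Y3), (Y2 + Y4).
by rewrite !mulmxDr addrACA.
Qed.

Lemma col_spanZ a E : col_span E -> col_span (a *: E).
Proof.
move=> [Y1 [Y2 ->]]; exists (a *: Y1), (a *: Y2).
by rewrite -!scalemxAr scalerDr.
Qed.

Lemma col_spanN E : col_span E -> col_span (- E).
Proof. by rewrite -scaleN1r; exact: col_spanZ. Qed.

End ColumnSpan.

(** * Consequences of the first- and second-order conditions *)

Section SecondOrderPoints.
Context {R : realType} {n m r k : nat} (A : {linear 'M[R]_n -> 'cV[R]_m}).
Context (X : 'M[R]_(n, r)) (Z : 'M[R]_(n, k)) (d nu : R).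
Hypotheses (d0 : 0 < d) (d1 : d < 1) (nu0 : 0 < nu).
Hypothesis rip : forall E : 'M[R]_n, (\rank E <= r + k)%N ->
    (1 - d) * frob2 E <= sqnorm (A E) / nu /\
    sqnorm (A E) / nu <= (1 + d) * frob2 E.

Local Notation E := (X *m X^T - Z *m Z^T).
Local Notation L V := (X *m V^T + V *m X^T).

Hypothesis foc : forall V : 'M[R]_(n, r), mip (A E) (A (L V)) = 0.
Hypothesis soc : forall V : 'M[R]_(n, r),
  0 <= mip (A (L V)) (A (L V)) + 2 * mip (A E) (A (V *m V^T)).

Let spE : col_span X Z E.
Proof. by apply: col_spanD (col_span_l _ _ _) (col_spanN (col_span_r _ _ _)). Qed.

(** The gradient condition at V = X gives <A E, A (X X^T)> = 0, so |A E|^2 = - <A E, A (Z Z^T)> <=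
    0, and the lower RIP bound yields E = 0. *)
Lemma recovery_of_nonneg : 0 <= mip (A E) (A (Z *m Z^T)) -> X *m X^T = Z *m Z^T.
Proof.
move=> EZ; apply/eqP; rewrite -subr_eq0 -mip_eq0 eq_le mip_ge0 andbT.
have EX : mip (A E) (A (X *m X^T)) = 0.
  by have := foc X; rewrite [A (_ + X *m X^T)]linearD mipDr; lra.
have AE0 : mip (A E) (A E) <= 0.
  by rewrite [Y in mip _ Y]linearB mipDr mipNr EX sub0r oppr_le0.
have [H _] := rip (col_span_rank spE).
have d1' : 0 < 1 - d by rewrite subr_gt0.
rewrite -(pmulr_rle0 _ d1') -frob2E; apply: le_trans H _.
by rewrite sqnormE mulr_le0_ge0 // invr_ge0 ltW.
Qed.

(** For X u = 0 the direction V = w u^T has no first-order effect on X X^T, so the Hessian gives <A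
    E, A (w w^T)> >= 0; sum over the columns w of Z. *)
Lemma recovery_of_rank_deficient (u : 'cV[R]_r) :
  mip u u = 1 -> X *m u = 0 -> X *m X^T = Z *m Z^T.
Proof.
move=> uu Xu; apply: recovery_of_nonneg.
rewrite [in Y in mip _ Y](mulmx_sum_cols Z) [Y in mip _ Y]linear_sum mip_sumr.
apply: sumr_ge0 => j _.
set w := col j Z; pose V := w *m u^T.
have VV : V *m V^T = w *m w^T.
  rewrite /V trmx_mul trmxK mulmxA -(mulmxA w) [u^T *m u]mx11_scalar mip_col uu.
  by rewrite mulmx1.
have LV : L V = 0.
  rewrite /V trmx_mul trmxK mulmxA Xu mul0mx add0r -mulmxA -trmx_mul Xu.
  by rewrite trmx0 mulmx0.
by have := soc V; rewrite LV VV linear0 mip0l add0r pmulr_rge0.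
Qed.

(** The Hessian at V = w u^T, for each column w of W. As X u and w are orthogonal, the first-order
    term has squared norm 2 |X u|^2 |w|^2, and the upper RIP bound applies. *)
Lemma curvature_bound (u : 'cV[R]_r) p (W : 'M[R]_(n, p)) :
  mip u u = 1 -> X^T *m W = 0 -> (exists Y1 Y2, W = X *m Y1 + Z *m Y2) ->
  - (1 + d) * mip (X *m u) (X *m u) * mip W W <=
  mip (A E) (A (W *m W^T)) / nu.
Proof.
move=> uu XW [Y1 [Y2 WE]].
rewrite (mulmx_sum_cols W) linear_sum mip_sumr mulr_suml (mip_sum_cols W) mulr_sumr.
apply: ler_sum => j _; set w := col j W.
have Xw : X^T *m w = 0 by rewrite /w colE mulmxA XW mul0mx.
pose V := w *m u^T.
have VV : V *m V^T = w *m w^T.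
  rewrite /V trmx_mul trmxK mulmxA -(mulmxA w) [u^T *m u]mx11_scalar mip_col uu.
  by rewrite mulmx1.
have LV : L V = X *m u *m w^T + w *m (X *m u)^T.
  by rewrite /V !trmx_mul trmxK !mulmxA.
have spL : col_span X Z (L V).
  apply: col_spanD; first exact: col_span_l.
  rewrite /V /w colE WE -!mulmxA mulmxDl -!mulmxA.
  exact: col_spanD (col_span_l _ _ _) (col_span_r _ _ _).
have := soc V; rewrite VV => H.
have [_] := rip (col_span_rank spL); rewrite sqnormE frob2E.
have -> : mip (L V) (L V) = 2 * mip (X *m u) (X *m u) * mip w w.
  rewrite LV; have pw : (X *m u)^T *m w = 0.
    by rewrite trmx_mul -mulmxA Xw mulmx0.
  have wp : w^T *m (X *m u) = 0 by rewrite -[LHS]trmxK trmx_mul trmxK pw trmx0.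
  have cross (a b : 'cV[R]_n) : mip (a *m b^T) (a *m b^T) = mip a a * mip b b.
    rewrite mip_cross_gram [a^T *m a]mx11_scalar [b^T *m b]mx11_scalar !mip_col.
    by rewrite /mip tr_scalar_mx -scalar_mxM mxtrace_scalar mulr1n.
  rewrite mipDl !mipDr !cross.
  have -> : mip (X *m u *m w^T) (w *m (X *m u)^T) = 0.
    by rewrite mip_mull mulmxA pw mul0mx mip0r.
  by rewrite (mip_mull w) [w^T *m _]mulmxA wp mul0mx mip0r; ring.
move=> H2.
have nu0' : 0 <= nu^-1 by rewrite invr_ge0 ltW.
have := mulr_ge0 H nu0'; move: H2; move: nu^-1 (mip (A (L V)) _) => c a.
by move: (mip (A E) _) => b; lra.
Qed.

(** A positive least singular value makes the factor P in X = Q P invertible, so Q and X have the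
    same column space and the whole tangent part of E is a first-order direction. *)
Lemma recovery_of_full_gain (u : 'cV[R]_r) (q : R) :
  mip u u = 1 -> 0 < mip (X *m u) (X *m u) ->
  (forall v : 'cV[R]_r,
    mip (X *m u) (X *m u) * mip v v <= mip (X *m v) (X *m v)) ->
  (r <= n)%N -> (k <= r)%N -> 1 <= q -> r%:R = q ^+ 2 * k%:R ->
  d < q / (1 + q) -> X *m X^T = Z *m Z^T.
Proof.
set s := mip (X *m u) (X *m u) => uu s0 smin rn kr q1 rE dq.
have [Q [P [QQ PT XE]]] := polar_decomposition X rn.
have mX (v : 'cV[R]_r) : mip (X *m v) (X *m v) = mip (P *m v) (P *m v).
  by rewrite XE -mulmxA mip_isometry.
have Pu : P \in unitmx.
  rewrite unitmxE unitfE; apply/negP => /det0P[v v0 vP].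
  have := smin v^T; rewrite mX -PT -trmx_mul vP trmx0 mip0l mip_tr.
  rewrite pmulr_rle0 // => /mip_le0 v00.
  by rewrite v00 eqxx in v0.
pose Z1 := Q^T *m Z; pose W := Z - Q *m Z1.
pose S := P *m P.
pose D := S - Z1 *m Z1^T.
have QW : Q^T *m W = 0 by rewrite mulmxBr !mulmxA QQ mul1mx subrr.
pose E1 := tangent_part Q D Z1 W; pose N := W *m W^T.
have ZE : Z = Q *m Z1 + W by rewrite addrC subrK.
have EE : E = E1 - N.
  by rewrite /E1 /N -tangent_partE -ZE XE trmx_mul PT /S !mulmxA.
have XW : X^T *m W = 0 by rewrite XE trmx_mul -mulmxA QW mulmx0.
have WE : W = X *m (- (invmx P *m Z1)) + Z *m 1%:M.
  by rewrite mulmx1 mulmxN mulmxA XE mulmxK // addrC.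
have hN := curvature_bound uu XW (ex_intro _ _ (ex_intro _ _ WE)).
have hE1 : mip (A E) (A E1) = 0.
  have DT : D^T = D.
    by rewrite /D /S; move: (Z1) => B; rewrite linearB /= !trmx_mul trmxK PT.
  have [Y E1Y] := tangent_part_sym Q Z1 W DT.
  (* Since X P^-1 = Q, this direction produces Q Y^T + Y Q^T, which is [E1]. *)
  have := foc (Y *m invmx P).
  have XP : X *m invmx P = Q by rewrite XE mulmxK.
  have XPt : invmx P *m X^T = Q^T by rewrite -XP trmx_mul trmx_inv PT.
  by rewrite trmx_mul trmx_inv PT mulmxA XP -(mulmxA Y) XPt -E1Y.
(* As h(E, E1) = 0, the weight c of [E1] is free; 1 / d^2 maximizes c - d^2 c^2 / 2, the part of the
   coefficient of |E1|^2 that depends on c. *)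
pose c := (d ^+ 2)^-1; pose T := c *: E1 - N.
have cd : c * d ^+ 2 = 1 by rewrite mulVf // sqrf_eq0 gt_eqF.
have spN : col_span X Z N.
  exists (- (invmx P *m Z1) *m W^T), (1%:M *m W^T).
  by rewrite /N {1}WE mulmxDl !mulmxA.
have spE1 : col_span X Z E1.
  have -> : E1 = E + N by rewrite EE subrK.
  exact: col_spanD.
have spT a : col_span X Z (E + a *: T).
  apply: col_spanD => //; apply: col_spanZ.
  by apply: col_spanD; [exact: col_spanZ|exact: col_spanN].
have HE : mip E T - (mip E E + d ^+ 2 * mip T T) / 2 <= mip (A E) (A T) / nu.
  apply: (RIP_cross d0 nu0 rip); first exact: (col_span_rank (spT d)).
  by rewrite -scaleNr; exact: (col_span_rank (spT (- d))).
have hT : mip (A E) (A T) / nu = - (mip (A E) (A N) / nu).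
  have -> : A T = c *: A E1 - A N by rewrite /T linearB linearZ.
  by rewrite mipDr mipZr hE1 mulr0 add0r mipNr mulNr.

have mEN : mip E1 N = 0 by exact: mip_tangent_normal.
have Ps (v : 'cV[R]_r) : s * mip v v <= mip (P *m v) (P *m v).
  by rewrite -mX; exact: smin.
have := tangent_normal_bound QQ QW kr (ltW s0) q1 rE PT Ps (erefl D).
rewrite -/E1 -/N; move: HE hN; rewrite hT -/N EE.
have eqE : mip E1 E1 <= 0 -> mip N N <= 0 -> X *m X^T = Z *m Z^T.
  move=> /mip_le0 E10 /mip_le0 N0.
  by apply/eqP; rewrite -subr_eq0 EE E10 N0 subrr.
rewrite /T -/s; clearbody E1 N W; rewrite !mip_lin (mipC N E1) mEN.
move: eqE (mip_ge0 E1) (mip_ge0 N).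
move: (mip E1 E1) (mip N N) (mip W W) (_ / nu) => e g w x eqE e0 g0 H1 H2 key.
have [d0' d1'] := (d0, d1).
(* With c d^2 = 1 the bound in [HE], multiplied by d^2, becomes (1 - d^2) (e + d^2 g) / 2; a factor
   1 + d then cancels. *)
have H3 : (1 - d) * (e + d ^+ 2 * g) <= 2 * d ^+ 2 * (s * w).
  have d1p : 0 < 1 + d by lra.
  rewrite -(ler_pM2l d1p).
  have := ler_wpM2l (sqr_ge0 d) (le_trans H1 (_ : - x <= (1 + d) * (s * w))).
  rewrite (_ : _ * (_ - _) = (c * d ^+ 2 * e + d ^+ 2 * g)
    - (d ^+ 2 * (e + g) + (c * d ^+ 2) ^+ 2 * e + d ^+ 2 * d ^+ 2 * g) / 2); last first.
    by field.
  rewrite cd => /(_ _); lra.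
have q1p : 0 < 1 + q by lra.
have dq' : d * (1 + q) < q by rewrite -ltr_pdivlMr.
have a2 : 0 < (1 - d) * (1 + q) - 1 by lra.
have q0 : 0 < q by lra.
have a1 : 0 < (1 - d) * (1 + q) * q ^+ 2 - (d * (1 + q)) ^+ 2.
  have : (d * (1 + q)) ^+ 2 < q ^+ 2 by rewrite ltr_pXn2r // nnegrE; nra.
  have : 0 < ((1 - d) * (1 + q) - 1) * q ^+ 2 by rewrite mulr_gt0 // exprn_gt0.
  lra.
(* Add q^2 (1 + q) times [H3] to d^2 times [key]: the terms in s w cancel. Both remaining
   coefficients are positive because d (1 + q) < q, so e and g vanish. *)
have H4 : e * ((1 - d) * (1 + q) * q ^+ 2 - (d * (1 + q)) ^+ 2) +
    g * (d ^+ 2 * q ^+ 2 * ((1 - d) * (1 + q) - 1)) <= 0.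
  have := ler_wpM2l (ltW (mulr_gt0 (exprn_gt0 2 q0) q1p)) H3.
  have := ler_wpM2l (sqr_ge0 d) key.
  by lra.
have a3 : 0 < d ^+ 2 * q ^+ 2 * ((1 - d) * (1 + q) - 1).
  by rewrite !mulr_gt0 // exprn_gt0.
apply: eqE.
  by rewrite -(pmulr_lle0 _ a1); have := mulr_ge0 g0 (ltW a3); lra.
by rewrite -(pmulr_lle0 _ a3); have := mulr_ge0 e0 (ltW a1); lra.
Qed.

End SecondOrderPoints.

(** * The equivalence between second-order points and recovery *)

Section ExactRecovery.
Context {R : realType} {n m r : nat} (A : {linear 'M[R]_n -> 'cV[R]_m}).

Lemma second_order_of_recovery (X : 'M[R]_(n, r)) :
  grad_zero (fA A (A (X *m X^T))) X /\ hess_psd (fA A (A (X *m X^T))) X.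
Proof.
split; first by apply/fA_grad_zero => V; rewrite subrr mip0l.
by apply/fA_hess_psd => V; rewrite subrr mip0l mulr0 addr0 mip_ge0.
Qed.

Lemma recovery_of_second_order k (Z : 'M[R]_(n, k)) (d : R) (X : 'M[R]_(n, r)) :
  (0 < r)%N -> (r <= n)%N -> (k <= r)%N -> RIP A d (r + k) ->
  d < 1 / (1 + Num.sqrt (k%:R / r%:R)) ->
  grad_zero (fA A (A (Z *m Z^T))) X -> hess_psd (fA A (A (Z *m Z^T))) X ->
  X *m X^T = Z *m Z^T.
Proof.
move=> r0 rn kr ripd dD /fA_grad_zero foc /fA_hess_psd soc.
have d0 : 0 <= d by case: ripd.
set D := 1 / _ in dD.
have sq0 : 0 <= Num.sqrt (k%:R / r%:R) :> R by exact: sqrtr_ge0.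
have D1 : D <= 1 by rewrite /D ler_pdivrMr; lra.
(* The later argument divides by the RIP constant, and d may be 0; raising it to the midpoint keeps
   it below the threshold. *)
pose d' := (d + D) / 2.
have [_ [d'1 [nu [nu0 rip]]]] : RIP A d' (r + k).
  by apply: (RIP_monotone ripd); rewrite /d'; lra.
have d'0 : 0 < d' by rewrite /d'; lra.
have d'D : d' < D by rewrite /d'; lra.
rewrite -linearB in foc soc.
have [u uu umin] := min_gain X r0.
have [s0|s0] := eqVneq (mip (X *m u) (X *m u)) 0.
  apply: (recovery_of_rank_deficient d'1 nu0 rip foc soc uu).
  by apply: mip_le0; rewrite s0.
have {}s0 : 0 < mip (X *m u) (X *m u) by rewrite lt_neqAle eq_sym s0 mip_ge0.
(* The ratio r / k below requires k > 0; for k = 0, Z Z^T is an empty sum. *)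
have [k0|k0] := posnP k.
  apply: (recovery_of_nonneg d'1 nu0 rip foc).
  have -> : Z *m Z^T = 0.
    apply/matrixP => i j; rewrite !mxE big1 // => l _.
    by have := leq_trans (ltn_ord l) (eq_leq k0).
  by rewrite (linear0 A) mip0r.
have rR : 0 < r%:R :> R by rewrite ltr0n.
have kR : 0 < k%:R :> R by rewrite ltr0n.
pose q : R := Num.sqrt (r%:R / k%:R).
have q2 : q ^+ 2 = r%:R / k%:R by rewrite sqr_sqrtr // divr_ge0 // ltW.
have q1 : 1 <= q.
  by rewrite -sqrtr1 ler_wsqrtr // ler_pdivlMr // mul1r ler_nat.
apply: (recovery_of_full_gain d'0 d'1 nu0 rip foc soc uu s0 umin rn kr q1).
  by rewrite q2 divfK // gt_eqF.
have -> : q / (1 + q) = D; last by [].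
have qi : Num.sqrt (k%:R / r%:R) = q^-1 :> R.
  by rewrite -sqrtrV ?invf_div // divr_ge0 // ltW.
rewrite /D qi; field.
by rewrite !gt_eqF //; lra.
Qed.

Lemma recovery_iff_second_order (M : 'M[R]_n) (d : R) (X : 'M[R]_(n, r)) :
  (0 < r)%N -> (r <= n)%N -> psd M -> (\rank M <= r)%N ->
  RIP A d (r + \rank M) ->
  d < 1 / (1 + Num.sqrt ((\rank M)%:R / r%:R)) ->
  grad_zero (fA A (A M)) X /\ hess_psd (fA A (A M)) X <-> X *m X^T = M.
Proof.
move=> r0 rn psdM Mr ripd dD; split=> [[foc soc]|<-]; last first.
  exact: second_order_of_recovery.
have [Z ME] := psd_factor psdM (leqnn _).
rewrite ME in foc soc; rewrite [RHS]ME.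
exact: (recovery_of_second_order r0 rn Mr ripd dD foc soc).
Qed.

End ExactRecovery.

(** * Spurious second-order points *)

Section SpuriousPoint.
Context {R : realType}.

Lemma mip_mxvec m n (A B : 'M[R]_(m, n)) : mip (mxvec A)^T (mxvec B)^T = mip A B.
Proof.
rewrite mip_tr !mipE big_ord_recl big_ord0 addr0.
rewrite (reindex _ (curry_mxvec_bij _ _)) /= pair_bigA.
by apply: eq_bigr => -[i j] _ /=; rewrite !mxvecE.
Qed.

(** The map scales the line of D by sqrt (1 - d) and its orthogonal complement by sqrt (1 + d), then
    flattens the matrix. *)
Lemma rank_one_perturbation n (D : 'M[R]_n) (d : R) :
  mip D D = 1 -> 0 <= d -> d < 1 ->
  exists A : {linear 'M[R]_n -> 'cV[R]_(n * n)}, forall T T',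
    mip (A T) (A T') = (1 + d) * mip T T' - 2 * d * mip D T * mip D T'.
Proof.
move=> DD d0 d1.
pose c1 := Num.sqrt (1 + d); pose c2 := Num.sqrt (1 - d) - c1.
pose f (T : 'M[R]_n) : 'cV[R]_(n * n) := (mxvec (c1 *: T + (c2 * mip D T) *: D))^T.
have f_linear : linear f.
  move=> x S T; rewrite /f.
  have -> : c1 *: (x *: S + T) + (c2 * mip D (x *: S + T)) *: D =
      x *: (c1 *: S + (c2 * mip D S) *: D) + (c1 *: T + (c2 * mip D T) *: D).
    by rewrite mipDr mipZr; apply/matrixP => i j; rewrite !mxE; ring.
  by rewrite linearD linearZ /= linearD linearZ.
pose fM := GRing.isLinear.Build _ _ _ _ f f_linear.
pose A : {linear 'M[R]_n -> 'cV[R]_(n * n)} := HB.pack f fM.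
exists A => T T'; rewrite /A /= /f mip_mxvec !mip_lin DD (mipC T D).
have c1E : c1 ^+ 2 = 1 + d by rewrite sqr_sqrtr //; lra.
have c2E : (c1 + c2) ^+ 2 = 1 - d by rewrite addrC subrK sqr_sqrtr //; lra.
transitivity (c1 ^+ 2 * mip T T' +
  ((c1 + c2) ^+ 2 - c1 ^+ 2) * mip D T * mip D T'); first by ring.
by rewrite c1E c2E; ring.
Qed.

(** With nu = 1, both bounds follow from 0 <= <D, T>^2 <= |T|^2. *)
Lemma RIP_rank_one_perturbation n m (A : {linear 'M[R]_n -> 'cV[R]_m}) (D : 'M[R]_n)
    (d : R) p : mip D D = 1 -> 0 <= d -> d < 1 ->
  (forall T T', mip (A T) (A T') = (1 + d) * mip T T' - 2 * d * mip D T * mip D T') ->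
  RIP A d p.
Proof.
move=> DD d0 d1 AE; split=> //; split=> //; exists 1; split=> // T _.
rewrite divr1 sqnormE frob2E AE.
have : 0 <= mip (T - mip D T *: D) (T - mip D T *: D) by exact: mip_ge0.
rewrite mipDl !mipDr !mipNl !mipNr !mipZl !mipZr DD (mipC T D) => H.
have H2 : 0 <= d * (mip T T - mip D T * mip D T) by rewrite mulr_ge0 //; lra.
have H3 : 0 <= d * (mip D T * mip D T) by rewrite mulr_ge0 // -expr2 sqr_ge0.
by split; lra.
Qed.

(** * Second-order conditions at the counterexample *)

Section Construction.
Context {n r : nat} (e : 'cV[R]_n) (X : 'M[R]_(n, r)) (a : 'M[R]_n) (d p : R).
Hypotheses (ee : mip e e = 1) (XX : isometry_mx X) (Xe : X^T *m e = 0).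
Hypotheses (aT : a^T = a) (ae : a *m e = 0) (aa : mip a a = 1).
Hypotheses (d0 : 0 < d) (d1 : d < 1) (p0 : 0 < p) (dp : p / (1 + p) <= d).

Local Notation b := (e *m e^T).
Local Notation D := ((Num.sqrt 2)^-1 *: (a - b)).
Local Notation E := (p *: a - (p / d) *: b).
Local Notation L V := (X *m V^T + V *m X^T).

Let sqrt2 : (Num.sqrt 2)^-1 ^+ 2 = 2^-1 :> R.
Proof. by rewrite exprVn sqr_sqrtr. Qed.

Let eX : e^T *m X = 0.
Proof. by rewrite -[LHS]trmxK trmx_mul trmxK Xe trmx0. Qed.

Let mip_b T : mip b T = mip e (T *m e).
Proof. by rewrite mip_mulr trmxK. Qed.

Let mip_ba : mip b a = 0.
Proof. by rewrite mip_b ae mip0r. Qed.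

Let mip_bb : mip b b = 1.
Proof. by rewrite mip_b -mulmxA [e^T *m e]mx11_scalar mip_col ee mulmx1. Qed.

Let mip_bL (V : 'M[R]_(n, r)) : mip b (L V) = 0.
Proof.
rewrite mip_b mulmxDl -!mulmxA Xe mulmx0 addr0 mipC mip_mull.
by rewrite Xe mip0r.
Qed.

Let mip_bVV (V : 'M[R]_(n, r)) : mip b (V *m V^T) = mip (V^T *m e) (V^T *m e).
Proof. by rewrite mip_b [RHS]mip_mull trmxK mulmxA. Qed.

Lemma unit_direction : mip D D = 1.
Proof.
rewrite !mipZr !mipZl mulrA -expr2 sqrt2; move: mip_ba mip_bb aa.
move: b => B; rewrite !mip_lin (mipC a B) => -> -> ->; lra.
Qed.

(** The coefficients of E are tuned so that the a-component cancels: (1 + d) p - d (p + p / d) = 0.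
    Only a multiple of b survives, which is orthogonal to every first-order direction. *)
Lemma mip_perturbed_residual (T : 'M[R]_n) :
  (1 + d) * mip E T - 2 * d * mip D E * mip D T = - (p / d - d * p) * mip b T.
Proof.
rewrite [mip D T]mipZl [mip D E]mipZl; move: mip_ba mip_bb aa.
move: b => B ba bb aa'.
rewrite !mip_lin (mipC a B) ba bb aa'.
move: (mip a T) (mip B T) sqrt2; move: (Num.sqrt 2)^-1 => h x y h2.
have dn0 : d != 0 by rewrite gt_eqF.
transitivity ((1 + d) * (p * x - p / d * y) - h ^+ 2 * (2 * d * (p + p / d) * (x - y))).
  by field.
by rewrite h2; field.
Qed.

(** Bessel's inequality: with w = X V^T e, the matrices a, w e^T and e w^T are pairwise orthogonal,
    and the latter two each pair with L V to |w|^2. *)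
Lemma tangent_norm_bound (V : 'M[R]_(n, r)) :
  mip a (L V) ^+ 2 + 2 * mip (V^T *m e) (V^T *m e) <= mip (L V) (L V).
Proof.
set al := mip a (L V); pose w := X *m (V^T *m e).
have Le : L V *m e = w by rewrite mulmxDl -!mulmxA Xe mulmx0 addr0.
have LT : (L V)^T = L V by rewrite linearD /= !trmx_mul !trmxK addrC.
have ww : mip w w = mip (V^T *m e) (V^T *m e) by exact: mip_isometry XX.
have ew : e^T *m w = 0 by rewrite mulmxA eX mul0mx.
have we : w^T *m e = 0 by rewrite -[LHS]trmxK trmx_mul trmxK ew trmx0.
rewrite -ww.
have BT : (e *m w^T)^T = w *m e^T by rewrite trmx_mul trmxK.
have mL1 : mip (L V) (w *m e^T) = mip w w by rewrite mipC mip_mulr trmxK Le.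
have mL2 : mip (L V) (e *m w^T) = mip w w.
  by rewrite -[LHS]mip_tr LT BT mL1.
have ma1 : mip a (w *m e^T) = 0 by rewrite mipC mip_mulr trmxK ae mip0r.
have ma2 : mip a (e *m w^T) = 0 by rewrite -[LHS]mip_tr aT BT ma1.
have m11 : mip (w *m e^T) (w *m e^T) = mip w w.
  by rewrite mip_mulr trmxK -mulmxA [e^T *m e]mx11_scalar mip_col ee mulmx1.
have m22 : mip (e *m w^T) (e *m w^T) = mip w w.
  by rewrite -[LHS]mip_tr BT m11.
have m12 : mip (w *m e^T) (e *m w^T) = 0.
  by rewrite mip_mulr trmxK -mulmxA we mulmx0 mip0r.
have : 0 <= mip (L V - (al *: a + w *m e^T + e *m w^T))
  (L V - (al *: a + w *m e^T + e *m w^T)) by exact: mip_ge0.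
move: mL1 mL2 ma1 ma2 m11 m22 m12 (erefl al); rewrite {1}/al.
move: (L V) (w *m e^T) (e *m w^T) al => K B C al mL1 mL2 ma1 ma2 m11 m22 m12 alE.
rewrite !mip_lin (mipC C B) (mipC B a) (mipC C a) (mipC B K) (mipC C K) (mipC K a).
by rewrite mL1 mL2 ma1 ma2 m11 m22 m12 alE aa; lra.
Qed.

Lemma spurious_point m (A : {linear 'M[R]_n -> 'cV[R]_m}) (M : 'M[R]_n) :
  (forall T T', mip (A T) (A T') = (1 + d) * mip T T' - 2 * d * mip D T * mip D T') ->
  X *m X^T - M = E ->
  let f := fun U : 'M[R]_(n, r) => sqnorm (A (U *m U^T - M)) in
  0 < f X /\ grad_zero f X /\ hess_psd f X.
Proof.
move=> AE ME f.
have c0 : 0 < p / d - d * p.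
  have -> : p / d - d * p = p * (1 - d ^+ 2) / d by field; rewrite gt_eqF.
  by rewrite divr_gt0 // mulr_gt0 // subr_gt0 expr_lt1 // ltW.
have AEE T : mip (A E) (A T) = - (p / d - d * p) * mip b T.
  by rewrite AE mip_perturbed_residual.
have fE : f = fA A (A M) by apply/funext => U; rewrite /f /fA linearB.
have resE : A (X *m X^T) - A M = A E by rewrite -linearB ME.
split.
  rewrite /f ME sqnormE AEE mipDr mipNr !mipZr mip_ba mip_bb mulr0 sub0r mulr1.
  by rewrite mulrNN mulr_gt0 // divr_gt0.
rewrite fE; split.
  by apply/fA_grad_zero => V; rewrite resE AEE mip_bL mulr0.
apply/fA_hess_psd => V; rewrite resE AEE mip_bVV AE.
have := tangent_norm_bound V; move: (mip_ge0 (V^T *m e)).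
rewrite [mip D _]mipZl mipDl mipNl mip_bL subr0.
move: (mip (V^T *m e) _) (mip a (L V)) (mip (L V) (L V)) => ro al l ro0 H.
have -> : 2 * d * ((Num.sqrt 2)^-1 * al) * ((Num.sqrt 2)^-1 * al) = d * al ^+ 2.
  have -> : 2 * d * ((Num.sqrt 2)^-1 * al) * ((Num.sqrt 2)^-1 * al) =
    (Num.sqrt 2)^-1 ^+ 2 * (2 * d * al ^+ 2) by ring.
  by rewrite sqrt2; field.
(* The left side is p (1 - d) (1 + d) / d, so this is p (1 - d) <= d, a rewriting of [dp]. It lets
   the term 2 (1 + d) |V^T e|^2 absorb the negative curvature. *)
have cd : p / d - d * p <= 1 + d.
  have -> : p / d - d * p = p * (1 - d) * (1 + d) / d by field; rewrite gt_eqF.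
  have p1 : 0 < 1 + p by rewrite addr_gt0.
  move: dp; rewrite ler_pdivrMr // => dp'.
  have [d0' d1'] := (d0, d1).
  rewrite ler_pdivrMr // mulrC; apply: ler_wpM2l; lra.
have [d0' d1'] := (d0, d1).
have H1 : 0 <= (1 + d) * (l - al ^+ 2 - 2 * ro) by rewrite mulr_ge0 //; lra.
have H2 : 0 <= (1 + d - (p / d - d * p)) * ro by rewrite mulr_ge0 //; lra.
by have := sqr_ge0 al; lra.
Qed.

End Construction.
End SpuriousPoint.

(** * Concrete data for the counterexample *)

Section Existence.
Context {R : realType}.

(** Split an isometry with 1 + r <= n columns into its first column and the rest. *)
Lemma isometry_with_normal n r : (r < n)%N ->
  exists (e : 'cV[R]_n) (X : 'M[R]_(n, r)),
    [/\ mip e e = 1, isometry_mx X & X^T *m e = 0].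
Proof.
move=> rn; pose Y : 'M[R]_(n, 1 + r) := pid_mx (1 + r).
have : Y^T *m Y = 1%:M by exact: pid_isometry rn.
rewrite -(hsubmxK Y) tr_row_mx mul_col_row (@scalar_mx_block _ 1 r).
move=> /eq_block_mx[ee _ Xe XX].
exists (lsubmx Y), (rsubmx Y); split=> //.
by rewrite -mip_col ee mxE eqxx.
Qed.

(** The invertible k by k matrix (Y^T Y)^2 factors through Y Y^T, whose rank is therefore at least
    k. *)
Lemma mxrank_gram_unit n k (Y : 'M[R]_(n, k)) :
  Y^T *m Y \in unitmx -> \rank (Y *m Y^T) = k.
Proof.
move=> Yu; apply/eqP; rewrite eqn_leq; apply/andP; split.
  exact: leq_trans (mxrankM_maxl _ _) (rank_leq_col _).
have rG : \rank (Y^T *m (Y *m Y^T) *m Y) = k.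
  by rewrite mulmxA -mulmxA mxrank_unit // unitmx_mul Yu.
rewrite -[leqLHS]rG.
exact: leq_trans (mxrankM_maxl _ _) (mxrankM_maxr _ _).
Qed.

Lemma psd_gram n k (Y : 'M[R]_(n, k)) : psd (Y *m Y^T).
Proof.
split=> [|v]; first by rewrite trmx_mul trmxK.
by rewrite -mulmxA mip_col -mulmxA mipC mip_mull mip_ge0.
Qed.

Lemma spurious_instance n r k (d : R) : (r < n)%N -> (1 <= k)%N -> (k <= r)%N ->
  1 / (1 + 1 / Num.sqrt ((r - k + 1)%:R)) <= d -> d < 1 ->
  exists (m : nat) (A : {linear 'M[R]_n -> 'cV[R]_m}) (M : 'M[R]_n)
         (X : 'M[R]_(n, r)),
    let f := fun U : 'M[R]_(n, r) => sqnorm (A (U *m U^T - M)) in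
    RIP A d (r + k) /\ psd M /\ \rank M = k /\
    X *m X^T <> M /\ 0 < f X /\ grad_zero f X /\ hess_psd f X.
Proof.
(* From here k is one less than the rank of [M]: k columns come from X and one from e. Hence p^2 = r
   - k, the rank of the projection [J]. *)
move=> rn; case: k => // k _ kr dD d1.
have [e [X [ee XX Xe]]] := isometry_with_normal rn.
pose K : 'M[R]_(r, k) := pid_mx k.
have KK : K^T *m K = 1%:M by apply: pid_isometry; exact: ltnW.
pose J := 1%:M - K *m K^T.
have JT : J^T = J by rewrite linearB /= trmx1 trmx_mul trmxK.
have JJ : J *m J = J.
  rewrite {1}/J mulmxBl mul1mx /J mulmxBr mulmx1 -mulmxA.
  by rewrite (mulmxA K^T) KK mul1mx subrr subr0.
move: dD; rewrite (_ : (r - k.+1 + 1)%N = (r - k)%N); last by rewrite addn1 subnSK.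
set p := Num.sqrt _ => dD.
have p0 : 0 < p by rewrite sqrtr_gt0 ltr0n subn_gt0.
have p2 : p ^+ 2 = r%:R - k%:R by rewrite sqr_sqrtr ?ler0n // natrB // ltnW.
have trJ : mip J J = p ^+ 2.
  by rewrite /mip JT JJ linearB /= mxtrace1 mxtrace_mulC KK mxtrace1 p2.
pose a := p^-1 *: (X *m J *m X^T).
have aT : a^T = a by rewrite linearZ /= !trmx_mul trmxK JT mulmxA.
have ae : a *m e = 0.
  by rewrite /a -scalemxAl -(mulmxA _ X^T) Xe mulmx0 scaler0.
have aa : mip a a = 1.
  rewrite mipZl mipZr mulrA mip_mulr trmxK -!mulmxA XX mulmx1.
  rewrite mip_isometry // trJ; field.
  by rewrite gt_eqF.
have dp : p / (1 + p) <= d.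
  apply: le_trans dD; rewrite le_eqVlt; apply/orP; left; apply/eqP; field.
  by rewrite !gt_eqF // addr_gt0.
have d0 : 0 < d by apply: lt_le_trans dp; rewrite divr_gt0 // addr_gt0.
have DD := unit_direction ee ae aa.
have [A AE] := rank_one_perturbation DD (ltW d0) d1.
(* M = (p / d) e e^T + X K K^T X^T, so X X^T - M = X J X^T - (p / d) e e^T, the residual required
   above. *)
pose g := Num.sqrt (p / d).
have g2 : g ^+ 2 = p / d by rewrite sqr_sqrtr // divr_ge0 // ltW.
pose Y := row_mx (g *: e) (X *m K).
pose M := Y *m Y^T.
have ME : X *m X^T - M = p *: a - (p / d) *: (e *m e^T).
  rewrite /M /Y tr_row_mx mul_row_col linearZ /= -scalemxAl -scalemxAr scalerA.
  rewrite -expr2 g2 trmx_mul /a scalerA mulfV ?gt_eqF // scale1r.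
  rewrite /J mulmxBr mulmxBl mulmx1 !mulmxA opprD addrA.
  by rewrite addrAC.
have [fX [gX hX]] := spurious_point ee XX Xe aT ae aa d0 d1 p0 dp AE ME.
exists (n * n)%N, A, M, X; split; first exact: RIP_rank_one_perturbation (ltW d0) d1 AE.
split; first exact: psd_gram.
split.
  rewrite /M; apply: (@mxrank_gram_unit n (1 + k) Y).
  have -> : Y^T *m Y = block_mx (g ^+ 2)%:M 0 0 1%:M.
    have geT : (g *: e)^T = g *: e^T by rewrite linearZ.
    rewrite /Y tr_row_mx mul_col_row geT; congr block_mx.
    - rewrite -scalemxAl -scalemxAr scalerA -expr2.
      by rewrite [e^T *m e]mx11_scalar mip_col ee scalemx1.
    - rewrite -scalemxAl mulmxA -[e^T *m X]trmxK trmx_mul trmxK Xe.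
      by rewrite trmx0 mul0mx scaler0.
    - by rewrite trmx_mul -scalemxAr -mulmxA Xe mulmx0 scaler0.
    - by rewrite trmx_mul mulmxA -(mulmxA K^T) XX mulmx1 KK.
  rewrite unitmxE det_ublock det1 mulr1 det_scalar1 unitfE g2.
  by rewrite gt_eqF // divr_gt0.
split; last by [].
by move=> XM; move: fX; rewrite XM subrr linear0 sqnormE mip0l ltxx.
Qed.

End Existence.

Unset Implicit Arguments.

Theorem theorem2 (R : realType) (n r : nat) (hr1 : (1 <= r)%N) (hrn : (r < n)%N) :
  (forall (m : nat) (A : {linear 'M[R]_n -> 'cV[R]_m}) (Mstar : 'M[R]_n) (delta : R),
     psd Mstar -> (\rank Mstar <= r)%N ->
     RIP A delta (r + \rank Mstar) ->
     delta < 1 / (1 + Num.sqrt ((\rank Mstar)%:R / r%:R)) ->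
     forall X : 'M[R]_(n, r),
       (grad_zero (fA A (A Mstar)) X /\ hess_psd (fA A (A Mstar)) X)
       <-> X *m X^T = Mstar)
  /\
  (forall (rstar : nat) (delta : R),
     (1 <= rstar)%N -> (rstar <= r)%N ->
     1 / (1 + 1 / Num.sqrt ((r - rstar + 1)%:R)) <= delta -> delta < 1 ->
     exists (m : nat) (A : {linear 'M[R]_n -> 'cV[R]_m}) (Mstar : 'M[R]_n)
            (X : 'M[R]_(n, r)),
       let f := fun U : 'M[R]_(n, r) => sqnorm (A (U *m U^T - Mstar)) in
       RIP A delta (r + rstar) /\ psd Mstar /\ \rank Mstar = rstar /\
       X *m X^T <> Mstar /\ 0 < f X /\ grad_zero f X /\ hess_psd f X).
Proof.
split=> [m A M d psdM Mr ripd dD X|k d k1 kr dD d1].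
  exact: recovery_iff_second_order hr1 (ltnW hrn) psdM Mr ripd dD.
exact: spurious_instance.
Qed.
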